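(* Let $\lambda,\lambda_s,\mu,R,C>0$ with $\lambda+\lambda_s<\mu$ and $R\ge C/\mu$. In the partially observable mean field model, the following is a (symmetric) Nash equilibrium strategy for the dedicated customers: $$q^e=\begin{cases}0, & 0<\dfrac{R}{C}\le\dfrac{\lambda_s+\mu}{\mu^2},\\[2mm] \dfrac{\mu}{\lambda}-\dfrac{C(\mu+\lambda_s)}{R\mu\lambda}, & \dfrac{\lambda_s+\mu}{\mu^2}<\dfrac{R}{C}<\dfrac{\mu+\lambda_s}{\mu(\mu-\lambda)},\\[2mm] 1, & \dfrac{R}{C}\ge\dfrac{\mu+\lambda_s}{\mu(\mu-\lambda)}.\end{cases}$$
   Context: Finite model: there are $N$ parallel queues, each with infinite waiting space and one server with exponential service rate $\mu$. Each queue has its own dedicated Poisson arrival stream of rate $\lambda$; an additional Poisson stream of rate $N\lambda_s$ brings ''smart'' customers, who each join a shortest queue. ''Partially observable'' means that dedicated customers do not observe the numbers of customers in the queues, while smart customers do. Smart customers always enter. A strategy of the dedicated customers is a joining probability $q\in[0,1]$ ($q=0$ is balking, $q=1$ is joining). Mean field model ($N\to\infty$) when dedicated customers use $q$: a single-server queue with exponential service rate $\mu$, Poisson dedicated arrivals of rate $\lambda q$, and extra (smart) arrivals that occur only when the queue is empty, at rate $\lambda_s/\pi_0$, where $\pi_0$ is the stationary probability that the queue is empty. Its stationary queue-length distribution is $\pi_0=1-\rho$, $\pi_k=\rho(1-\sigma)\sigma^{k-1}$ for $k\ge1$, with $\rho=(\lambda q+\lambda_s)/\mu$ and $\sigma=\lambda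 q/\mu$. The mean sojourn time of a joining dedicated customer is $E(W(q))=\sum_{k\ge0}\frac{k+1}{\mu}\pi_k$. Each customer receives reward $R$ after service and pays waiting cost $C$ per unit time in the system. When the dedicated customers use $q$, the expected utility of joining for a dedicated customer is $S(q)=R-C\,E(W(q))$, and the utility of balking is $0$. Thus a dedicated customer who joins with probability $r\in[0,1]$ while all other dedicated customers use $q$ has expected utility $r\,S(q)$. A strategy $q^e\in[0,1]$ is a (symmetric) Nash equilibrium if $q^e$ is a best response to itself, i.e. $q^e S(q^e)\ge r\,S(q^e)$ for all $r\in[0,1]$. *)

(* Defs.v *)
From Stdlib Require Import Reals Lra Lia.
From Coquelicot Require Import Coquelicot.
Open Scope R_scope.

(** Arrival rate of the mean field queue in state [k], given the probability
    [p0] that the queue is empty: smart customers (rate [lambda_s] per queue)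
    join only empty queues, hence the rate [lambda_s / p0] in state [0]. *)
Definition arrival_rate (lambda lambda_s q p0 : R) (k : nat) : R :=
  match k with
  | O => lambda * q + lambda_s / p0
  | S _ => lambda * q
  end.

(** [p] is a stationary distribution of the mean field queue: a probability
    distribution on [nat], with an attainable empty state, solving the global
    balance equations of the birth-death chain. The rates depend on [p 0]. *)
Definition is_stationary (lambda lambda_s mu q : R) (p : nat -> R) : Prop :=
  let a := arrival_rate lambda lambda_s q (p 0%nat) in
  (forall k, 0 <= p k) /\ 0 < p 0%nat /\ is_series p 1 /\
  a 0%nat * p 0%nat = mu * p 1%nat /\
  (forall k, (a (S k) + mu) * p (S k) = a k * p k + mu * p (S (S k))).

(** The unique stationary distribution, see [stationary_unique]. Convention
    [0 ^ 0 = 1]: for [q = 0] the mass at [1] is [rho]. *)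
Definition queue_law (lambda lambda_s mu q : R) (k : nat) : R :=
  let rho := (lambda * q + lambda_s) / mu in
  let sigma := lambda * q / mu in
  match k with
  | O => 1 - rho
  | S j => rho * (1 - sigma) * sigma ^ j
  end.

(** The series converges under the stability condition, see
    [ex_series_sojourn]. *)
Definition mean_sojourn (lambda lambda_s mu q : R) : R :=
  Series (fun k => INR (k + 1) / mu * queue_law lambda lambda_s mu q k).

(** [S(q)]: expected utility of joining when the other dedicated customers
    use [q]. *)
Definition joining_utility (lambda lambda_s mu reward cost q : R) : R :=
  reward - cost * mean_sojourn lambda lambda_s mu q.

(** Expected utility of a dedicated customer joining with probability [r]
    while the others use [q]; balking is worth [0]. *)
Definition dedicated_utility (lambda lambda_s mu reward cost r q : R) : R :=
  r * joining_utility lambda lambda_s mu reward cost q.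

Definition is_symmetric_nash (lambda lambda_s mu reward cost q : R) : Prop :=
  0 <= q <= 1 /\
  forall r, 0 <= r <= 1 ->
    dedicated_utility lambda lambda_s mu reward cost q q >=
    dedicated_utility lambda lambda_s mu reward cost r q.

(** For [lambda < mu] the two thresholds are strictly ordered, so the last
    branch is exactly the case [reward / cost >= upper threshold]. *)
Definition q_equilibrium (lambda lambda_s mu reward cost : R) : R :=
  if Rle_dec (reward / cost) ((lambda_s + mu) / mu ^ 2) then 0
  else if Rlt_dec (reward / cost) ((mu + lambda_s) / (mu * (mu - lambda)))
  then mu / lambda - cost * (mu + lambda_s) / (reward * mu * lambda)
  else 1.

Lemma sigma_bounds (lambda lambda_s mu q : R) :
  0 < lambda -> 0 < lambda_s -> lambda + lambda_s < mu -> 0 <= q <= 1 ->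
  0 <= lambda * q / mu < 1 /\ 0 <= (lambda * q + lambda_s) / mu < 1.
Proof.
intros Hl Hs Hm Hq.
assert (H0 : 0 <= lambda * q) by nra.
assert (H1 : lambda * q <= lambda) by nra.
assert (Hi : 0 < / mu) by (apply Rinv_0_lt_compat; lra).
assert (Hmi : mu * / mu = 1) by (apply Rinv_r; lra).
unfold Rdiv; repeat split; nra.
Qed.

Lemma is_series_geom_scal (a s : R) :
  0 <= s < 1 -> is_series (fun k => a * s ^ k) (a / (1 - s)).
Proof.
intros Hs.
apply (is_series_scal a (fun k => s ^ k) (/ (1 - s))).
apply is_series_geom; rewrite Rabs_pos_eq; lra.
Qed.

Lemma is_series_cons (p : nat -> R) (l : R) :
  is_series (fun k => p (S k)) l -> is_series p (p 0%nat + l).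
Proof.
intros H; apply is_series_decr_1.
assert (E : l = p 0%nat + l + - p 0%nat) by ring.
rewrite E in H; exact H.
Qed.

Lemma stationary_unique (lambda lambda_s mu q : R) (p : nat -> R) :
  0 < lambda -> 0 < lambda_s -> lambda + lambda_s < mu -> 0 <= q <= 1 ->
  (is_stationary lambda lambda_s mu q p <->
   forall k, p k = queue_law lambda lambda_s mu q k).
Proof.
intros Hl Hs Hm Hq.
destruct (sigma_bounds lambda lambda_s mu q Hl Hs Hm Hq) as [Hsig Hrho].
assert (Hmu : 0 < mu) by lra.
set (s := lambda * q / mu) in *; set (rho := (lambda * q + lambda_s) / mu) in *.
assert (Es : lambda * q = mu * s) by (unfold s; field; lra).
assert (Er : lambda_s = mu * (rho - s)) by (unfold s, rho; field; lra).
split.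
- intros (Hpos & H0 & Hsum & B0 & B).
  assert (Cut : forall k, arrival_rate lambda lambda_s q (p 0%nat) k * p k
                          = mu * p (S k)).
  { induction k as [|k IH]; [exact B0|]. specialize (B k). lra. }
  assert (C0 : p 1%nat = s * p 0%nat + (rho - s)).
  { specialize (Cut 0%nat); simpl in Cut.
    replace ((lambda * q + lambda_s / p 0%nat) * p 0%nat)
      with (lambda * q * p 0%nat + lambda_s) in Cut by (field; lra).
    rewrite Es, Er in Cut.
    apply (Rmult_eq_reg_l mu); lra. }
  assert (Ck : forall k, p (S k) = p 1%nat * s ^ k).
  { induction k as [|k IH]; [simpl; ring|].
    specialize (Cut (S k)); simpl in Cut; rewrite Es, IH in Cut.
    apply (Rmult_eq_reg_l mu); [simpl; lra | lra]. }
  assert (T : is_series p (p 0%nat + p 1%nat / (1 - s))).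
  { apply is_series_cons.
    apply (is_series_ext (fun k => p 1%nat * s ^ k)).
    - intros k; symmetry; apply Ck.
    - apply is_series_geom_scal; lra. }
  assert (E : p 0%nat + p 1%nat / (1 - s) = 1).
  { rewrite <- (is_series_unique _ _ T); exact (is_series_unique _ _ Hsum). }
  assert (E0 : p 0%nat = 1 - rho).
  { assert (X : p 0%nat * (1 - s) + p 1%nat = 1 - s).
    { replace (p 0%nat * (1 - s) + p 1%nat)
        with ((p 0%nat + p 1%nat / (1 - s)) * (1 - s)) by (field; lra).
      rewrite E; ring. }
    rewrite C0 in X; lra. }
  intros [|k]; unfold queue_law; fold s rho; [exact E0|].
  rewrite Ck, C0, E0; ring.
- intros Hp.
  assert (P0 : p 0%nat = 1 - rho) by (rewrite Hp; reflexivity).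
  assert (Pk : forall k, p (S k) = rho * (1 - s) * s ^ k)
    by (intros k; rewrite Hp; reflexivity).
  assert (A0 : (lambda * q + lambda_s / p 0%nat) * p 0%nat = mu * p 1%nat).
  { replace ((lambda * q + lambda_s / p 0%nat) * p 0%nat)
      with (lambda * q * p 0%nat + lambda_s) by (field; lra).
    rewrite Es, Er, P0, Pk; simpl; ring. }
  unfold is_stationary; split; [|split; [|split; [|split]]].
  + intros [|k]; [lra|]. rewrite Pk.
    apply Rmult_le_pos; [apply Rmult_le_pos; lra | apply pow_le; lra].
  + lra.
  + replace 1 with (p 0%nat + rho * (1 - s) / (1 - s))
      by (rewrite P0; field; lra).
    apply is_series_cons.
    apply (is_series_ext (fun k => rho * (1 - s) * s ^ k)).
    * intros k; symmetry; apply Pk.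
    * apply is_series_geom_scal; lra.
  + exact A0.
  + intros [|k]; unfold arrival_rate.
    * rewrite A0, Es, !Pk; simpl; ring.
    * rewrite Es, !Pk; simpl; ring.
Qed.

Lemma ex_series_sojourn (lambda lambda_s mu q : R) :
  0 < lambda -> 0 < lambda_s -> lambda + lambda_s < mu -> 0 <= q <= 1 ->
  ex_series (fun k => INR (k + 1) / mu * queue_law lambda lambda_s mu q k).
Proof.
intros Hl Hs Hm Hq.
destruct (sigma_bounds lambda lambda_s mu q Hl Hs Hm Hq) as [Hsig Hrho].
apply ex_series_incr_1; unfold queue_law.
set (s := lambda * q / mu) in *; set (rho := (lambda * q + lambda_s) / mu) in *.
apply (ex_series_ext (fun k => scal (rho * (1 - s) / mu) (INR (k + 2) * s ^ k))).
{ intros k; replace (S k + 1)%nat with (k + 2)%nat by lia.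
  change (rho * (1 - s) / mu * (INR (k + 2) * s ^ k)
          = INR (k + 2) / mu * (rho * (1 - s) * s ^ k)).
  unfold Rdiv; ring. }
apply (ex_series_scal (V := R_NormedModule)).
destruct (Req_dec s 0) as [E|E].
- apply ex_series_incr_1.
  apply (ex_series_ext (fun k => 0 * 0 ^ k)).
  + intros k; rewrite E, (pow_ne_zero (S k)) by lia; rewrite Rmult_0_l; symmetry; apply Rmult_0_r.
  + eexists; apply (is_series_geom_scal 0 0); lra.
- apply ex_series_Rabs, (ex_series_DAlembert _ s); [lra| |].
  + intros k; apply Rmult_integral_contrapositive; split.
    * apply not_0_INR; lia.
    * apply pow_nonzero; exact E.
  + apply (is_lim_seq_ext (fun k => s * (1 + / (INR k + 2)))).
    * intros k; rewrite Rabs_pos_eq.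
      -- assert (P := pos_INR k); rewrite !plus_INR, S_INR; simpl.
         field; split; [apply pow_nonzero; exact E | lra].
      -- apply Rle_mult_inv_pos.
         ++ apply Rmult_le_pos; [apply pos_INR | apply pow_le; lra].
         ++ apply Rmult_lt_0_compat; [apply lt_0_INR; lia | apply pow_lt; lra].
    * replace (Finite s) with (Rbar_mult s (Finite (1 + 0)))
        by (simpl; f_equal; ring).
      apply is_lim_seq_scal_l.
      apply is_lim_seq_plus'; [apply is_lim_seq_const|].
      replace (Finite 0) with (Rbar_inv p_infty) by reflexivity.
      apply is_lim_seq_inv; [|discriminate].
      apply (is_lim_seq_plus _ _ p_infty 2 p_infty);
        [apply is_lim_seq_INR | apply is_lim_seq_const | reflexivity].
Qed.

(* Main.v *)
Require Import Defs.
From Stdlib Require Import Reals.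
From Stdlib Require Import Lra Lia.
From Coquelicot Require Import Coquelicot.
Open Scope R_scope.

(** Summing the mean sojourn time gives
    [E(W(q)) = (mu + lambda_s) / (mu * (mu - lambda * q))]
    ([mean_sojourn_closed_form]), which increases with [q]: a dedicated customer
    who joins makes joining less attractive to the others. The two thresholds
    for [reward / cost] are its values at [q = 0] and [q = 1], and the interior
    formula for the equilibrium is the solution of
    [reward / cost = E(W(q))]. A strategy [q] is a best response to itself as
    soon as joining is not attractive where some customers balk, and not
    repulsive where some customers join ([nash_of_complementarity]). So nobody
    joins when joining is not attractive even in an all-balking population,
    everybody joins when it is not repulsive even in an all-joining population,
    and otherwise [q] is the point where customers are indifferent. *)

(** The utility [r * joining_utility q] is linear in [r], so a best response is
    decided by the sign of its slope at [q]. *)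
Lemma nash_of_complementarity (lambda lambda_s mu reward cost q : R) :
  0 <= q <= 1 ->
  (0 < q -> 0 <= joining_utility lambda lambda_s mu reward cost q) ->
  (q < 1 -> joining_utility lambda lambda_s mu reward cost q <= 0) ->
  is_symmetric_nash lambda lambda_s mu reward cost q.
Proof.
intros Hq Hjoin Hbalk; split; [exact Hq|]; intros r Hr.
unfold dedicated_utility.
set (u := joining_utility lambda lambda_s mu reward cost q) in *.
destruct (Rle_lt_dec q r) as [Hle|Hlt].
- destruct (Req_dec q r) as [->|Hne]; [lra|].
  assert (u <= 0) by (apply Hbalk; lra); nra.
- assert (0 <= u) by (apply Hjoin; lra); nra.
Qed.

(** The law has geometric tail, [pi_(k+2) = sigma * pi_(k+1)], so the terms
    [a_k = (k+1) * pi_k / mu] of the mean satisfy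
    [a_(k+2) = sigma * a_(k+1) + pi_(k+2) / mu]. Since the series converges,
    summing this recursion over [k] gives a linear equation for its sum. *)
Lemma mean_sojourn_closed_form (lambda lambda_s mu q : R) :
  0 < lambda -> 0 < lambda_s -> lambda + lambda_s < mu -> 0 <= q <= 1 ->
  mean_sojourn lambda lambda_s mu q
  = (mu + lambda_s) / (mu * (mu - lambda * q)).
Proof.
intros Hl Hs Hm Hq.
destruct (sigma_bounds lambda lambda_s mu q Hl Hs Hm Hq) as [Hsig _].
assert (Hmu : 0 < mu) by lra.
assert (Hlq : lambda * q < mu) by nra.
assert (Hex := ex_series_sojourn lambda lambda_s mu q Hl Hs Hm Hq).
unfold mean_sojourn.
set (a := fun k => INR (k + 1) / mu * queue_law lambda lambda_s mu q k) in *.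
set (s := lambda * q / mu) in *.
set (rho := (lambda * q + lambda_s) / mu).
assert (Hex1 : ex_series (fun k => a (S k)))
  by (apply (ex_series_incr_1 a); exact Hex).
assert (E0 : a 0%nat = (1 - rho) / mu)
  by (unfold a; simpl; fold rho; field; lra).
assert (E1 : a 1%nat = 2 * rho * (1 - s) / mu)
  by (unfold a; simpl; fold rho s; field; lra).
(* [c] is [pi_2 / mu]. *)
set (c := s * rho * (1 - s) / mu).
assert (Hgeom := is_series_geom_scal c s Hsig).
assert (Rec : forall k, a (S (S k)) = s * a (S k) + c * s ^ k).
{ intros k; unfold a, c; simpl queue_law; fold rho s.
  replace (S (S k) + 1)%nat with (S (S k + 1)) by lia.
  rewrite (S_INR (S k + 1)); field; lra. }
assert (Sum : Series (fun k => a (S (S k)))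
              = s * Series (fun k => a (S k)) + c / (1 - s)).
{ rewrite (Series_ext _ _ Rec), Series_plus, Series_scal_l.
  - now rewrite (is_series_unique _ _ Hgeom).
  - apply (ex_series_scal (V := R_NormedModule)); exact Hex1.
  - eexists; exact Hgeom. }
assert (D0 := Series_incr_1 a Hex).
assert (D1 := Series_incr_1 (fun k => a (S k)) Hex1).
cbv beta in D1; rewrite Sum, E1 in D1.
set (T := Series (fun k => a (S k))) in *.
assert (ET : T = (2 * rho * (1 - s) / mu + c / (1 - s)) / (1 - s)).
{ apply (Rmult_eq_reg_r (1 - s)); [|lra].
  unfold Rdiv at 1; rewrite Rmult_assoc, Rinv_l by lra; lra. }
rewrite D0, E0, ET; unfold c, rho, s; field; lra.
Qed.

(** Multiplying the utility by the positive factor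
    [mu * (mu - lambda * q)] leaves a polynomial whose sign can be compared
    with each threshold. *)
Lemma joining_utility_numerator (lambda lambda_s mu reward cost q : R) :
  0 < lambda -> 0 < lambda_s -> lambda + lambda_s < mu -> 0 <= q <= 1 ->
  joining_utility lambda lambda_s mu reward cost q * (mu * (mu - lambda * q))
  = reward * (mu * (mu - lambda * q)) - cost * (mu + lambda_s).
Proof.
intros Hl Hs Hm Hq; unfold joining_utility.
rewrite mean_sojourn_closed_form by assumption.
field; split; nra.
Qed.

Lemma Rdiv_le_cross (a b c d : R) :
  0 < b -> 0 < d -> a / b <= c / d <-> a * d <= c * b.
Proof.
intros Hb Hd.
replace (a * d) with (a / b * (b * d)) by (field; lra).
replace (c * b) with (c / d * (b * d)) by (field; lra).
assert (0 < b * d) by nra.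
split; intros H'.
- apply Rmult_le_compat_r; lra.
- apply (Rmult_le_reg_r (b * d)); lra.
Qed.

Theorem theorem3p2 (lambda lambda_s mu reward cost : R)
  (Hlambda : 0 < lambda) (Hlambda_s : 0 < lambda_s) (Hmu : 0 < mu)
  (Hreward : 0 < reward) (Hcost : 0 < cost)
  (Hstable : lambda + lambda_s < mu)
  (Hworth : reward >= cost / mu) :
  is_symmetric_nash lambda lambda_s mu reward cost
    (q_equilibrium lambda lambda_s mu reward cost).
Proof.
assert (Hnum := fun q => joining_utility_numerator lambda lambda_s mu reward
                           cost q Hlambda Hlambda_s Hstable).
assert (Hmu2 : 0 < mu ^ 2) by nra.
assert (Hmul : 0 < mu * (mu - lambda)) by nra.
unfold q_equilibrium.
destruct (Rle_dec _ _) as [Hlow|Hlow];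
  rewrite Rdiv_le_cross in Hlow by assumption.
- apply nash_of_complementarity; [lra | lra |]; intros _.
  specialize (Hnum 0 ltac:(lra)); nra.
- apply Rnot_le_lt in Hlow.
  destruct (Rlt_dec _ _) as [Hup|Hup].
  + apply Rlt_not_le in Hup; rewrite Rdiv_le_cross in Hup by assumption.
    apply Rnot_le_lt in Hup.
    set (q := mu / lambda - cost * (mu + lambda_s) / (reward * mu * lambda)).
    assert (Hpos : 0 < reward * mu) by nra.
    assert (Eq : lambda * q * (reward * mu)
                 = reward * mu ^ 2 - cost * (mu + lambda_s))
      by (unfold q; field; lra).
    assert (Hq : 0 < q < 1).
    { assert (0 < lambda * (reward * mu)) by nra.
      split; apply (Rmult_lt_reg_r (lambda * (reward * mu))); nra. }
    specialize (Hnum q ltac:(lra)).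
    assert (Hden : 0 < mu * (mu - lambda * q)) by nra.
    assert (Hzero : joining_utility lambda lambda_s mu reward cost q = 0).
    { apply (Rmult_eq_reg_r (mu * (mu - lambda * q))); [rewrite Hnum|]; nra. }
    apply nash_of_complementarity; lra.
  + apply Rnot_lt_le in Hup; rewrite Rdiv_le_cross in Hup by assumption.
    apply nash_of_complementarity; [lra | | lra]; intros _.
    specialize (Hnum 1 ltac:(lra)); rewrite Rmult_1_r in Hnum; nra.
Qed.
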